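(* Let $\mathcal{A}=\{A_1,\ldots,A_m\}$ be a finite set of real $n\times n$ matrices, and consider the associated switched linear system $x_{k+1}=A_{\sigma(k)}x_k$ (with arbitrary switching $\sigma:\mathbb{Z}\to\{1,\ldots,m\}$) or the linear difference inclusion $x_{k+1}\in \mathrm{co}(\mathcal{A})\,x_k$. If there exist $K$ symmetric positive definite matrices $P_1,\ldots,P_K$ such that for some $\gamma>1$ $$\forall (i,j)\in\{1,\ldots,m\}\times\{1,\ldots,K\},\ \exists k\in\{1,\ldots,K\}\ \text{such that}\ \gamma^2A_i^TP_jA_i\preceq P_k,$$ then the system is absolutely asymptotically stable, i.e., $\rho(\mathcal{A})<1$. Moreover, the pointwise maximum $\max\{x^TP_1x,\ldots,x^TP_Kx\}$ of the quadratic functions is a common Lyapunov function for $\mathcal{A}$.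
   Context: The joint spectral radius is $\rho(\mathcal{A})=\lim_{k\to\infty}\max_{\sigma\in\{1,\ldots,m\}^k}\|A_{\sigma_k}\cdots A_{\sigma_1}\|^{1/k}$. $\mathrm{co}(\mathcal{A})$ is the convex hull of $\mathcal{A}$. Absolute asymptotic stability means global asymptotic stability (of the origin) for all switching sequences (respectively, for all selections in the difference inclusion); it is equivalent, for both systems, to $\rho(\mathcal{A})<1$. $P\preceq Q$ means $Q-P$ is positive semidefinite. A common Lyapunov function for $\mathcal{A}$ is a continuous, positive definite, homogeneous function $V:\mathbb{R}^n\to\mathbb{R}$ such that for some $\gamma>1$, $V(\gamma A_ix)\le V(x)$ for all $i=1,\ldots,m$ and all $x\in\mathbb{R}^n$. *)

(* Defs.v *)
From HB Require Import structures.
From mathcomp Require Import all_boot all_order all_algebra.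
From mathcomp Require Import all_classical all_reals all_analysis.

Set Implicit Arguments.
Unset Strict Implicit.
Unset Printing Implicit Defensive.

Import Order.TTheory GRing.Theory Num.Theory.
Import numFieldNormedType.Exports.

Local Open Scope classical_set_scope.
Local Open Scope ring_scope.

(* A finite set {A_1, ..., A_m} of matrices is given as a nonempty family
   A : 'I_m.+1 -> 'M[R]_n, so it has m.+1 members; likewise P_1, ..., P_K is a
   family indexed by 'I_K.+1. *)

Definition quad (R : realType) (n : nat) (P : 'M[R]_n) (x : 'cV[R]_n) : R :=
  (x^T *m P *m x) 0 0.

Definition posdefmx (R : realType) (n : nat) (P : 'M[R]_n) : Prop :=
  P^T = P /\ forall x : 'cV[R]_n, x != 0 -> 0 < quad P x.

Definition possemidefmx (R : realType) (n : nat) (P : 'M[R]_n) : Prop :=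
  P^T = P /\ forall x : 'cV[R]_n, 0 <= quad P x.

Definition loewner_le (R : realType) (n : nat) (P Q : 'M[R]_n) : Prop :=
  possemidefmx (Q - P).

(* The starting value of the iterated maximum is one of the terms, so that this
   is the maximum of exactly the K.+1 numbers quad (P j) x. *)
Definition max_quad (R : realType) (n K : nat) (P : 'I_K.+1 -> 'M[R]_n)
    (x : 'cV[R]_n) : R :=
  \big[Num.max/quad (P ord0) x]_(j < K.+1) quad (P j) x.

(* Nonnegativity of N follows from these axioms; N need not be
   submultiplicative. *)
Definition is_mxnorm (R : realType) (n : nat) (N : 'M[R]_n -> R) : Prop :=
  [/\ forall M1 M2, N (M1 + M2) <= N M1 + N M2,
      forall (c : R) M, N (c *: M) = `|c| * N M
    & forall M, N M = 0 -> M = 0].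

(* For s = [:: s_1; ...; s_k], this is A_(s_k) *m ... *m A_(s_1). *)
Definition switch_prod (R : realType) (n m : nat) (A : 'I_m.+1 -> 'M[R]_n)
    (s : seq 'I_m.+1) : 'M[R]_n :=
  \big[mulmx/1%:M]_(i <- rev s) A i.

(* The default value 0 of the maximum is harmless: all the terms are
   nonnegative and there is at least one. *)
Definition jsr_seq (R : realType) (n m : nat) (N : 'M[R]_n -> R)
    (A : 'I_m.+1 -> 'M[R]_n) : R^nat :=
  fun k => \big[Num.max/0]_(s : k.-tuple 'I_m.+1)
             (N (switch_prod A s) `^ k%:R^-1).

(* [limn] has a junk value on divergent sequences: a claim about [jsr N A]
   should be accompanied by [cvgn (jsr_seq N A)]. *)
Definition jsr (R : realType) (n m : nat) (N : 'M[R]_n -> R)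
    (A : 'I_m.+1 -> 'M[R]_n) : R :=
  limn (jsr_seq N A).

Definition mxhull (R : realType) (n m : nat) (A : 'I_m.+1 -> 'M[R]_n) :
    set 'M[R]_n :=
  smallest (@convex_set R 'M[R]_n) (range A).

(* Global asymptotic stability of the origin for a system given by the set of
   its trajectories: Lyapunov stability and global attractivity. *)
Definition gas (R : realType) (n : nat) (traj : set (nat -> 'cV[R]_n)) : Prop :=
  (forall eps : R, 0 < eps ->
     exists2 delta : R, 0 < delta &
       forall x, traj x -> `|x 0%N| < delta -> forall k, `|x k| < eps) /\
  (forall x, traj x -> x @ \oo --> (0 : 'cV[R]_n)).

(* Trajectories for a fixed switching sequence sigma, from any initial time
   k0 : x k is the state at time k0 + k. *)
Definition switched_traj (R : realType) (n m : nat) (A : 'I_m.+1 -> 'M[R]_n)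
    (sigma : int -> 'I_m.+1) : set (nat -> 'cV[R]_n) :=
  [set x | exists k0 : int,
     forall k : nat, x k.+1 = A (sigma (k0 + k%:Z)) *m x k].

Definition inclusion_traj (R : realType) (n m : nat)
    (A : 'I_m.+1 -> 'M[R]_n) : set (nat -> 'cV[R]_n) :=
  [set x | forall k : nat, [set M *m x k | M in mxhull A] (x k.+1)].

Definition switched_aas (R : realType) (n m : nat) (A : 'I_m.+1 -> 'M[R]_n) :
    Prop :=
  forall sigma : int -> 'I_m.+1, gas (switched_traj A sigma).

(* Stability is uniform over all the selections: delta is chosen before the
   trajectory. *)
Definition inclusion_aas (R : realType) (n m : nat) (A : 'I_m.+1 -> 'M[R]_n) :
    Prop :=
  gas (inclusion_traj A).

Definition positive_definite_fun (R : realType) (n : nat) (V : 'cV[R]_n -> R) :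
    Prop :=
  V 0 = 0 /\ forall x, x != 0 -> 0 < V x.

Definition homogeneous_fun (R : realType) (n : nat) (V : 'cV[R]_n -> R) :
    Prop :=
  exists2 d : nat, (0 < d)%N &
    forall (lambda : R) x, V (lambda *: x) = lambda ^+ d * V x.

Definition common_lyapunov (R : realType) (n m : nat) (A : 'I_m.+1 -> 'M[R]_n)
    (V : 'cV[R]_n -> R) : Prop :=
  [/\ continuous V, positive_definite_fun V, homogeneous_fun V &
      exists2 gamma : R, 1 < gamma &
        forall i x, V (gamma *: (A i *m x)) <= V x].

(* Main.v *)
Require Import Defs.
From mathcomp Require Import all_boot all_order all_algebra.
From mathcomp Require Import all_classical all_reals all_analysis.
From mathcomp Require Import ring.
Import Order.TTheory GRing.Theory Num.Theory.
Import numFieldNormedType.Exports.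
Local Open Scope classical_set_scope.
Local Open Scope ring_scope.

Set Implicit Arguments.
Unset Strict Implicit.
Unset Printing Implicit Defensive.

(** Let V be the pointwise maximum of the quadratic forms of the P_j.  The
    matrix inequalities say that each of the functions x |-> x^T P_j x, taken at
    gamma *: (A_i *m x), is below some x^T P_k x, hence below V x; maximizing
    over j gives V (gamma *: (A_i *m x)) <= V x ([max_quad_contract]).  With
    continuity, positivity and homogeneity of degree 2, this is the Lyapunov
    claim.

    As a maximum of convex functions V is convex, so for fixed x the matrices M
    with V (gamma *: (M *m x)) <= V x form a convex set, which therefore contains
    the convex hull of the A_i ([max_quad_contract_hull]).  Thus V shrinks at
    least by the factor gamma ^- 2 at each step of the inclusion, and since V is comparable
    to the square of the norm ([max_quad_norm_equiv], by compactness of the unit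
    sphere), trajectories decay like gamma ^- k ([inclusion_decay]), uniformly
    over all selections.  Both stability claims follow, a switched trajectory
    being a trajectory of the inclusion.

    The columns of a product of k matrices A_i are states reached after k steps,
    so the same estimate bounds the norm of the product by B * gamma ^- k
    ([switch_prod_decay]).  For an arbitrary norm N, the maxima b k of N over the
    products of length k satisfy b (k + l) <= C * (b k * b l), because all norms
    are equivalent; the multiplicative form of Fekete's lemma
    ([cvg_root_quasi_submultiplicative]) makes the k-th roots of b k converge, and
    the geometric bound shows that their limit is at most gamma^-1 < 1. *)

(** * Roots of submultiplicative sequences *)

Lemma cvg_root_const (R : realType) (c : R) : 0 < c ->
  (fun k : nat => c `^ k%:R^-1) @ \oo --> (1 : R).
Proof.
move=> c0; rewrite -cvg_shiftS /=.
have -> : (fun k : nat => c `^ k.+1%:R^-1) =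
    (fun k => expR (harmonic k * ln c)).
  by apply/funext => k; rewrite /powR gt_eqF.
rewrite -expR0; apply: continuous_cvg; first exact: continuous_expR.
by rewrite -[X in _ --> X](mul0r (ln c)); apply: cvgMl; exact: cvg_harmonic.
Qed.

Lemma root_le (R : realType) (b r D : R) (k : nat) :
  (0 < k)%N -> 0 <= b -> 0 <= r -> 0 <= D ->
  b <= D * r ^+ k -> b `^ k%:R^-1 <= D `^ k%:R^-1 * r.
Proof.
move=> k0 b0 r0 D0 bD.
have -> : D `^ k%:R^-1 * r = (D * r ^+ k) `^ k%:R^-1.
  rewrite powRM ?exprn_ge0// -powR_mulrn// -powRrM mulfV ?powRr1//.
  by rewrite pnatr_eq0 -lt0n.
by apply: ge0_ler_powR => //; rewrite nnegrE ?mulr_ge0 ?exprn_ge0 ?invr_ge0.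
Qed.

(** A single value [u p <= r ^+ p] controls the growth of the whole sequence:
    write k = q * p + (k %% p), peel off q factors [u p], and absorb the finitely
    many possible remainders into the constant. *)
Lemma submultiplicative_geometric_bound (R : realType) (u : R^nat)
    (p : nat) (r : R) :
  (forall k, 0 <= u k) -> (forall k l, u (k + l)%N <= u k * u l) ->
  (0 < p)%N -> 0 < r -> u p <= r ^+ p ->
  exists2 D, 0 < D & forall k, u k <= D * r ^+ k.
Proof.
move=> u0 uM p0 r0 up.
have D0 : 0 <= \sum_(i < p) u i / r ^+ i.
  by apply: sumr_ge0 => i _; rewrite divr_ge0 ?exprn_ge0 ?(ltW r0).
exists (1 + \sum_(i < p) u i / r ^+ i) => [|k]; first exact: ltr_pwDl.
suff uq q : u (q * p + k %% p)%N <= u (k %% p)%N * r ^+ (q * p).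
  rewrite {1}(divn_eq k p); apply: (le_trans (uq _)).
  rewrite [in leRHS](divn_eq k p) addnC exprD mulrA ler_pM2r ?exprn_gt0//.
  rewrite -ler_pdivrMr ?exprn_gt0// (bigD1 (Ordinal (ltn_pmod k p0)))//=.
  rewrite addrCA lerDl; apply: addr_ge0 => //; apply: sumr_ge0 => i _.
  by rewrite divr_ge0 ?exprn_ge0 ?(ltW r0).
elim: q => [|q IH]; first by rewrite mul0n add0n expr0 mulr1.
rewrite mulSn -addnA exprD mulrCA; apply: (le_trans (uM _ _)).
exact: ler_pM.
Qed.

(** Fekete's lemma in multiplicative form: the limit is the infimum of the roots
    over k > 0.  A root within e / 2 of the infimum yields a geometric bound,
    whose constant is lost in the limit of the roots.  The argument avoids
    logarithms, so vanishing terms need no separate treatment. *)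
Lemma cvg_root_submultiplicative (R : realType) (u : R^nat) :
  (forall k, 0 <= u k) -> (forall k l, u (k + l)%N <= u k * u l) ->
  cvgn (fun k => u k `^ k%:R^-1).
Proof.
move=> u0 uM; pose w k := u k `^ k%:R^-1.
pose S := [set w k | k in [set k | (0 < k)%N]].
have lbS : lbound S 0 by move=> _ [k _ <-]; exact: powR_ge0.
have infS : has_inf S by split; [exists (w 1%N), 1%N | exists 0].
have L0 : 0 <= inf S by apply: lb_le_inf => //; case: infS.
apply/cvg_ex; exists (inf S); apply/cvgrPdist_lt => e e0.
have e20 : 0 < e / 2 by rewrite divr_gt0.
have [_ [p /= p0 <-] wp] := inf_adherent e20 infS.
set r := inf S + e / 2 in wp.
have r0 : 0 < r by rewrite ltr_wpDl.
have up : u p <= r ^+ p.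
  have -> : u p = w p ^+ p.
    by rewrite -powR_mulrn ?powR_ge0// -powRrM mulVf ?powRr1// pnatr_eq0 -lt0n.
  by rewrite lerXn2r ?nnegrE ?powR_ge0// ltW.
have [D D0 uD] := submultiplicative_geometric_bound u0 uM p0 r0 up.
have hr : (fun k : nat => D `^ k%:R^-1 * r) @ \oo --> r.
  by rewrite -[X in _ --> X]mul1r; apply: cvgMl; exact: cvg_root_const.
have rlt : r < inf S + e by rewrite ltrD2l ltr_pdivrMr// mulr_natr mulr2n ltrDl.
near=> k.
have k0 : (0 < k)%N by near: k; exact: nbhs_infty_gt.
have wk : inf S <= w k by apply: ge_inf; [case: infS | exists k].
rewrite distrC ger0_norm ?subr_ge0// ltrBlDl.
apply: (le_lt_trans (root_le k0 (u0 k) (ltW r0) (ltW D0) (uD k))).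
by near: k; exact: (cvgr_lt r).
Unshelve. all: by end_near. Qed.

(** [C * b k] is submultiplicative, and the k-th root of [C] tends to 1. *)
Lemma cvg_root_quasi_submultiplicative (R : realType) (C : R) (b : R^nat) :
  0 < C -> (forall k, 0 <= b k) ->
  (forall k l, b (k + l)%N <= C * (b k * b l)) ->
  cvgn (fun k => b k `^ k%:R^-1).
Proof.
move=> C0 b0 bM.
have /cvg_ex[L hL] : cvgn (fun k => (C * b k) `^ k%:R^-1).
  apply: cvg_root_submultiplicative => [k|k l].
    by rewrite mulr_ge0 ?(ltW C0).
  by rewrite -mulrA ler_pM2l// mulrCA.
apply/cvg_ex; exists (C^-1 `^ 0 * L).
have -> : (fun k => b k `^ k%:R^-1) =
   (fun k => (C^-1 `^ k%:R^-1) * (C * b k) `^ k%:R^-1).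
  apply/funext => k; rewrite -powRM ?invr_ge0 ?mulr_ge0 ?(ltW C0)//.
  by rewrite mulKf// gt_eqF.
by rewrite powRr0; apply: cvgM => //; apply: cvg_root_const; rewrite invr_gt0.
Qed.

Lemma lim_root_le (R : realType) (b : R^nat) (D r : R) :
  0 < D -> 0 <= r -> (forall k, 0 <= b k <= D * r ^+ k) ->
  cvgn (fun k => b k `^ k%:R^-1) -> limn (fun k => b k `^ k%:R^-1) <= r.
Proof.
move=> D0 r0 bD cb.
have hr : (fun k : nat => D `^ k%:R^-1 * r) @ \oo --> r.
  by rewrite -[X in _ --> X]mul1r; apply: cvgMl; exact: cvg_root_const.
rewrite -(cvg_lim _ hr)//; apply: ler_lim => //.
  by apply/cvg_ex; exists r.
near=> k; have k0 : (0 < k)%N by near: k; exact: nbhs_infty_gt.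
by have /andP[? ?] := bD k; apply: root_le => //; exact: ltW.
Unshelve. all: by end_near. Qed.

(** * Norms on spaces of matrices *)

Section matrix_norms.
Variable R : realType.

Lemma mx_norm_leP p q (M : 'M[R]_(p, q)) (b : R) : 0 <= b ->
  (`|M| <= b <-> forall i j, `|M i j| <= b).
Proof.
move=> b0; rewrite [`|M|]/Num.Def.normr /= mx_normrE; split=> [Mb i j|Mb].
  pose F (ij : 'I_p * 'I_q) := `|M ij.1 ij.2|.
  exact: le_trans (le_bigmax _ F (i, j)) Mb.
by apply: bigmax_le => // -[i j] _; exact: Mb.
Qed.

Lemma normr_coord_le p q (M : 'M[R]_(p, q)) i j : `|M i j| <= `|M|.
Proof. by move: i j; apply/(mx_norm_leP M (normr_ge0 M)). Qed.

Lemma norm_mulmx_le p q r (M : 'M[R]_(p, q)) (N : 'M[R]_(q, r)) :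
  `|M *m N| <= q%:R * (`|M| * `|N|).
Proof.
have ge0 : 0 <= q%:R * (`|M| * `|N|) by rewrite !mulr_ge0.
apply/(mx_norm_leP _ ge0) => i j.
rewrite mxE; apply: (le_trans (ler_norm_sum _ _ _)).
rewrite mulr_natl -[X in _ *+ X](card_ord q) -sumr_const.
by apply: ler_sum => k _; rewrite normrM ler_pM ?normr_coord_le.
Qed.

Lemma norm_vec_mx p q (v : 'rV[R]_(p * q)) : `|vec_mx v| = `|v|.
Proof.
apply/le_anti/andP; split; apply/(mx_norm_leP _ (normr_ge0 _)) => i j.
  by rewrite mxE normr_coord_le.
rewrite ord1; case/mxvec_indexP: j => k l.
by rewrite -{1}(vec_mxK v) mxvecE normr_coord_le.
Qed.

Lemma vec_mx_continuous p q : continuous (@vec_mx R p q).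
Proof.
move=> v; apply/(@cvgrPdist_lt _ _ _ (nbhs v)) => e e0; near=> w.
rewrite -linearB norm_vec_mx; near: w.
exact: cvgr_dist_lt cvg_id _ e0.
Unshelve. all: by end_near. Qed.

(** The sphere is the isometric image under [vec_mx] of a closed bounded set of
    row vectors. *)
Lemma mx_sphere_compact p q : compact [set M : 'M[R]_(p, q) | `|M| = 1].
Proof.
have -> : [set M : 'M[R]_(p, q) | `|M| = 1] =
    vec_mx @` [set v : 'rV[R]_(p * q) | `|v| = 1].
  apply/seteqP; split=> [M /= M1|_ [v /= v1 <-]]; last first.
    by rewrite /= norm_vec_mx.
  by exists (mxvec M); rewrite ?mxvecK//= -norm_vec_mx mxvecK.
apply: continuous_compact.
  by apply: continuous_subspaceT; exact: vec_mx_continuous.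
apply: bounded_closed_compact.
  exists 1; split=> [|x x1 v /= ->]; [exact: num_real | exact: ltW].
have : continuous (fun v : 'rV[R]_(p * q) => `|v|) by exact: norm_continuous.
by move/continuous_closedP => /(_ [set x : R | x = 1]); apply; exact: closed_eq.
Qed.

(** Both bounds are the extreme values of [f] on the unit sphere, which is
    compact.  This covers the equivalence of norms (d = 1) as well as the
    comparison of a positive definite quadratic function with the square of the
    norm (d = 2). *)
Lemma homogeneous_norm_equiv p q d (f : 'M[R]_(p, q) -> R) :
  (0 < d)%N -> continuous f -> (forall M, M != 0 -> 0 < f M) ->
  (forall a M, f (a *: M) = `|a| ^+ d * f M) ->
  exists c C, [/\ 0 < c, 0 < C &
    forall M, c * `|M| ^+ d <= f M <= C * `|M| ^+ d].
Proof.
move=> d0 fc f0 fZ.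
have f00 : f 0 = 0 by rewrite -(scale0r 0) fZ normr0 expr0n gtn_eqF// mul0r.
(* For empty matrices the sphere is empty, and any constants do. *)
have [M0|M0] := pselect (exists M : 'M[R]_(p, q), M != 0); last first.
  exists 1, 1; split=> // M; have [->|Mn0] := eqVneq M 0.
    by rewrite f00 normr0 expr0n gtn_eqF// mulr0 lexx.
  by exfalso; apply: M0; exists M.
pose S := [set M : 'M[R]_(p, q) | `|M| = 1].
have nS M : M != 0 -> S (`|M|^-1 *: M).
  by move=> Mn0; rewrite /S /= normrZ normfV normr_id mulVf ?normr_eq0.
have Sn0 : S !=set0 by have [M /nS SM] := M0; exists (`|M|^-1 *: M).
have fcS : {within S, continuous f} by exact: continuous_subspaceT.
have [c cS minf] := compact_EVT_min Sn0 (@mx_sphere_compact p q) fcS.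
have [C CS maxf] := compact_EVT_max Sn0 (@mx_sphere_compact p q) fcS.
have fpos M : M \in S -> 0 < f M.
  rewrite inE => SM; apply: f0; apply: contra_eq_neq SM => ->.
  by rewrite normr0 eq_sym oner_neq0.
exists (f c), (f C); split; [exact: fpos | exact: fpos |] => M.
have [->|Mn0] := eqVneq M 0.
  by rewrite f00 normr0 expr0n gtn_eqF// !mulr0 lexx.
have -> : f M = f (`|M|^-1 *: M) * `|M| ^+ d.
  rewrite fZ normfV normr_id mulrAC -exprMn mulVf ?normr_eq0//.
  by rewrite expr1n mul1r.
have MS : `|M|^-1 *: M \in S by rewrite inE; exact: nS.
by rewrite !ler_pM2r ?exprn_gt0 ?normr_gt0// minf// maxf.
Qed.
End matrix_norms.

Section abstract_norm.
Variables (R : realType) (n : nat) (N : 'M[R]_n -> R).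
Hypothesis hN : is_mxnorm N.

Lemma mxnorm0 : N 0 = 0.
Proof. by case: hN => _ NZ _; rewrite -(scale0r 0) NZ normr0 mul0r. Qed.

Lemma mxnorm_ge0 M : 0 <= N M.
Proof.
case: hN => ND NZ _; have := ND M (- M).
rewrite subrr mxnorm0 -scaleN1r NZ normrN1 mul1r -mulr2n.
by rewrite pmulrn_lge0.
Qed.

(** Expand a matrix on the elementary matrices [delta_mx i j]. *)
Lemma mxnorm_le : exists2 C, 0 < C & forall M, N M <= C * `|M|.
Proof.
case: hN => ND NZ _.
have Nsum I (r : seq I) (F : I -> 'M[R]_n) :
    N (\sum_(i <- r) F i) <= \sum_(i <- r) N (F i).
  elim: r => [|i r IH]; first by rewrite !big_nil mxnorm0.
  by rewrite !big_cons (le_trans (ND _ _))// lerD2l.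
have D0 : 0 <= \sum_i \sum_j N (delta_mx i j).
  by apply: sumr_ge0 => i _; apply: sumr_ge0 => j _; exact: mxnorm_ge0.
exists (1 + \sum_i \sum_j N (delta_mx i j)) => [|M]; first by rewrite ltr_pwDl.
apply: (@le_trans _ _ ((\sum_i \sum_j N (delta_mx i j)) * `|M|)); last first.
  by rewrite ler_wpM2r// lerDr.
rewrite {1}(matrix_sum_delta M) mulr_suml (le_trans (Nsum _ _ _))//.
apply: ler_sum => i _.
rewrite mulr_suml (le_trans (Nsum _ _ _))// ler_sum// => j _.
by rewrite NZ mulrC ler_wpM2l ?mxnorm_ge0 ?normr_coord_le.
Qed.

Lemma mxnorm_continuous : continuous N.
Proof.
case: hN => ND NZ _; have [C C0 NC] := mxnorm_le.
have Ndist M1 M2 : N M1 - N M2 <= C * `|M1 - M2|.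
  by rewrite lerBlDr -{1}(subrK M2 M1) (le_trans (ND _ _))// lerD2r.
move=> M; apply/(@cvgrPdist_lt _ _ _ (nbhs M)) => e e0; near=> M'.
apply: (@le_lt_trans _ _ (C * `|M - M'|)).
  by rewrite ler_norml lerNl opprB Ndist distrC Ndist.
rewrite -ltr_pdivlMl//; near: M'.
have e'0 : 0 < C^-1 * e by rewrite mulr_gt0 ?invr_gt0.
exact: cvgr_dist_lt cvg_id _ e'0.
Unshelve. all: by end_near. Qed.

(** A norm need not be submultiplicative, but it is so up to a constant, being
    equivalent to the maximum norm, which has this property. *)
Lemma mxnorm_mulmx : exists2 C, 0 < C &
  forall M1 M2, N (M1 *m M2) <= C * (N M1 * N M2).
Proof.
case: (hN) => _ NZ N0.
have Npos M : M != 0 -> 0 < N M.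
  move=> M0; rewrite lt_def mxnorm_ge0 andbT.
  by apply: contra M0 => /eqP/N0/eqP.
have [//|//|c [C [c0 C0 cNC]]] :=
  @homogeneous_norm_equiv _ _ _ 1 _ _ mxnorm_continuous Npos.
have cN M : `|M| <= c^-1 * N M.
  by rewrite ler_pdivlMl//; case/andP: (cNC M).
exists (1 + C * n%:R * (c^-1 * c^-1)) => [|M1 M2].
  by rewrite ltr_pwDl// !mulr_ge0 ?invr_ge0 ?(ltW c0) ?(ltW C0).
apply: (@le_trans _ _ (C * n%:R * (c^-1 * c^-1) * (N M1 * N M2))); last first.
  by rewrite ler_wpM2r ?mulr_ge0 ?mxnorm_ge0// lerDr.
have /andP[_ /le_trans->//] := cNC (M1 *m M2).
rewrite -!mulrA ler_wpM2l ?(ltW C0)//.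
apply: (le_trans (norm_mulmx_le _ _)); rewrite ler_wpM2l// mulrA mulrACA.
by rewrite ler_pM.
Qed.
End abstract_norm.

(** * The maximum of positive definite quadratic forms *)

Section quadratic_forms.
Variables (R : realType) (n : nat).

Lemma quad_sum (P : 'M[R]_n) (x : 'cV[R]_n) :
  quad P x = \sum_j (\sum_i x i 0 * P i j) * x j 0.
Proof.
rewrite /quad mxE; apply: eq_bigr => j _; rewrite mxE; congr (_ * _).
by apply: eq_bigr => i _; rewrite mxE.
Qed.

Lemma quad_continuous (P : 'M[R]_n) : continuous (quad P).
Proof.
have -> : quad P = fun x => \sum_j (\sum_i x i 0 * P i j) * x j 0.
  by apply/funext => x; rewrite quad_sum.
have sumC I (r : seq I) (f : I -> 'cV[R]_n -> R) :
    (forall i, continuous (f i)) -> continuous (fun x => \sum_(i <- r) f i x).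
  move=> fc; apply: (@continuous_big R^o _ _ _ _ (@add_continuous R^o)) => i _.
  exact: fc.
apply: (@sumC) => j x.
apply: (@cvgM _ _ (nbhs x)); last exact: coord_continuous.
move: x; apply: (@sumC) => i x.
by apply: (@cvgMl _ _ (nbhs x)); exact: coord_continuous.
Qed.

Lemma quadZ (P : 'M[R]_n) a x : quad P (a *: x) = a ^+ 2 * quad P x.
Proof. by rewrite /quad [_^T]linearZ /= -scalemxAr -!scalemxAl !mxE mulrA. Qed.

Lemma quad_congruence (P M : 'M[R]_n) a x :
  quad P (a *: (M *m x)) = quad (a ^+ 2 *: (M^T *m P *m M)) x.
Proof.
by rewrite quadZ /quad trmx_mul -scalemxAr -scalemxAl [in RHS]mxE !mulmxA.
Qed.

Lemma quad_le (P Q : 'M[R]_n) x : loewner_le P Q -> quad P x <= quad Q x.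
Proof.
by case=> _ /(_ x); rewrite /quad mulmxBr mulmxBl !mxE subr_ge0.
Qed.

Lemma quad_ge0 (P : 'M[R]_n) x : posdefmx P -> 0 <= quad P x.
Proof.
case=> _ P0; have [->|/P0/ltW//] := eqVneq x 0.
by rewrite /quad mulmx0 mxE.
Qed.

(** The defect of convexity is t * (1 - t) * quad P (x - y). *)
Lemma quad_convex (P : 'M[R]_n) (t : R) x y : posdefmx P -> 0 <= t <= 1 ->
  quad P (t *: x + (1 - t) *: y) <= t * quad P x + (1 - t) * quad P y.
Proof.
move=> hP /andP[t0 t1]; rewrite -subr_ge0.
have -> : t * quad P x + (1 - t) * quad P y - quad P (t *: x + (1 - t) *: y)
   = t * (1 - t) * quad P (x - y).
  have trD (u v : 'cV[R]_n) : (u + v)^T = u^T + v^T by rewrite linearD.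
  have trN (u : 'cV[R]_n) : (- u)^T = - u^T by rewrite linearN.
  have trZ a (u : 'cV[R]_n) : (a *: u)^T = a *: u^T by rewrite linearZ.
  rewrite /quad !trD trN !trZ !mulmxDl !mulmxDr.
  rewrite !(mulmxN, mulNmx) -!scalemxAl -!scalemxAr !mxE.
  ring.
by rewrite !mulr_ge0 ?subr_ge0 ?quad_ge0.
Qed.

Section max.
Variables (K : nat) (P : 'I_K.+1 -> 'M[R]_n).

Lemma quad_le_max j x : quad (P j) x <= max_quad P x.
Proof. exact: (le_bigmax _ (fun j => quad (P j) x)). Qed.

Lemma max_quad_le x b : (forall j, quad (P j) x <= b) -> max_quad P x <= b.
Proof. by move=> Pb; exact: bigmax_le. Qed.

Lemma max_quad_continuous : continuous (max_quad P).
Proof.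
rewrite /max_quad; elim: (index_enum _) => [|j r IH].
  have -> : (fun x => \big[Num.max/quad (P ord0) x]_(j <- [::]) quad (P j) x) =
      quad (P ord0) by apply/funext => x; rewrite big_nil.
  exact: quad_continuous.
have -> : (fun x => \big[Num.max/quad (P ord0) x]_(i <- j :: r) quad (P i) x) =
    quad (P j) \max
      (fun x => \big[Num.max/quad (P ord0) x]_(i <- r) quad (P i) x).
  by apply/funext => x; rewrite big_cons.
by move=> x; apply: continuous_max; [exact: quad_continuous | exact: IH].
Qed.

Lemma max_quadZ a x : max_quad P (a *: x) = a ^+ 2 * max_quad P x.
Proof.
have le b y : max_quad P (b *: y) <= b ^+ 2 * max_quad P y.
  by apply: max_quad_le => j; rewrite quadZ ler_wpM2l ?sqr_ge0 ?quad_le_max.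
apply/le_anti; rewrite le /=; have [->|a0] := eqVneq a 0.
  rewrite expr0n mul0r scale0r; apply: le_trans (quad_le_max ord0 0).
  by rewrite /quad mulmx0 mxE.
rewrite -ler_pdivlMl ?exprn_even_gt0// -exprVn.
(* The reverse inequality is [le] for the inverse scalar. *)
by apply: le_trans (le _ _); rewrite scalerA mulVf// scale1r.
Qed.

Hypothesis hP : forall j, posdefmx (P j).

Lemma max_quad_gt0 x : x != 0 -> 0 < max_quad P x.
Proof.
move=> x0; apply: lt_le_trans (quad_le_max ord0 x).
by case: (hP ord0) => _; apply.
Qed.

Lemma max_quad_convex t x y : 0 <= t <= 1 ->
  max_quad P (t *: x + (1 - t) *: y) <=
    t * max_quad P x + (1 - t) * max_quad P y.
Proof.
move=> t01; apply: max_quad_le => j.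
apply: le_trans (quad_convex _ _ (hP j) t01) _.
by case/andP: t01 => t0 t1; rewrite lerD// ler_wpM2l ?quad_le_max ?subr_ge0.
Qed.

Lemma max_quad_norm_equiv : exists c C, [/\ 0 < c, 0 < C &
  forall x : 'cV[R]_n, c * `|x| ^+ 2 <= max_quad P x <= C * `|x| ^+ 2].
Proof.
apply: homogeneous_norm_equiv => //; first exact: max_quad_continuous.
  exact: max_quad_gt0.
by move=> a x; rewrite max_quadZ real_normK ?num_real.
Qed.

(** The square root of [max_quad P] is comparable to the norm.  Since [g], [k],
    [x] and [y] are quantified after [B], one constant serves all trajectories
    and all words at every time. *)
Lemma norm_le_of_max_quad_decay : exists2 B, 0 < B &
  forall (g : R) k x y, 0 < g -> g ^+ 2 ^+ k * max_quad P y <= max_quad P x ->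
    `|y| <= B * `|x| * g^-1 ^+ k.
Proof.
have [c [C [c0 C0 cVC]]] := max_quad_norm_equiv.
exists (Num.sqrt (C / c)); first by rewrite sqrtr_gt0 divr_gt0.
move=> g k x y g0 gV; rewrite -(@ler_pXn2r _ 2)// ?nnegrE//; last first.
  by rewrite !mulr_ge0 ?exprn_ge0 ?invr_ge0 ?sqrtr_ge0 ?(ltW g0).
rewrite !exprMn sqr_sqrtr ?divr_ge0 ?(ltW c0) ?(ltW C0)//.
have -> : (g^-1 ^+ k) ^+ 2 = (g ^+ 2 ^+ k)^-1 by rewrite !exprVn -!exprM mulnC.
rewrite ler_pdivlMr ?exprn_gt0// [C / c]mulrC -[leRHS]mulrA.
rewrite ler_pdivlMl// mulrA mulrC.
have /andP[cV _] := cVC y; have /andP[_ VC] := cVC x.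
apply: le_trans VC; apply: le_trans gV.
by rewrite ler_wpM2l ?exprn_ge0 ?(ltW g0).
Qed.

End max.
End quadratic_forms.

(** * Products of matrices and the convex hull *)

Section products.
Variables (R : realType) (n m : nat) (A : 'I_m.+1 -> 'M[R]_n).

Lemma switch_prod_rcons s i :
  switch_prod A (rcons s i) = A i *m switch_prod A s.
Proof. by rewrite /switch_prod rev_rcons big_cons. Qed.

Lemma switch_prod_cat s t :
  switch_prod A (s ++ t) = switch_prod A t *m switch_prod A s.
Proof.
elim/last_ind: t => [|t i IH].
  by rewrite cats0 /switch_prod big_nil mul1mx.
by rewrite -rcons_cat !switch_prod_rcons IH mulmxA.
Qed.

Lemma mxhull_mem i : mxhull A (A i).
Proof. by apply: sub_gen_smallest; exists i. Qed.
End products.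

(** * Contraction and decay *)

Section contraction.
Variables (R : realType) (n m K : nat) (A : 'I_m.+1 -> 'M[R]_n).
Variables (P : 'I_K.+1 -> 'M[R]_n) (gamma : R).
Hypothesis hP : forall j, posdefmx (P j).
Hypothesis hgamma : 1 < gamma.
Hypothesis hA : forall (i : 'I_m.+1) (j : 'I_K.+1), exists k : 'I_K.+1,
     loewner_le (gamma ^+ 2 *: ((A i)^T *m P j *m A i)) (P k).

Lemma max_quad_contract i x : max_quad P (gamma *: (A i *m x)) <= max_quad P x.
Proof.
apply: max_quad_le => j; have [k Ak] := hA i j.
by rewrite quad_congruence (le_trans (quad_le x Ak))// quad_le_max.
Qed.

(** For a fixed [x] the matrices that contract [max_quad P] at [x] form a convex
    set, and this set contains every [A i]. *)
Lemma max_quad_contract_hull M x : mxhull A M ->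
  gamma ^+ 2 * max_quad P (M *m x) <= max_quad P x.
Proof.
suff sub : mxhull A `<=`
    [set M | max_quad P (gamma *: (M *m x)) <= max_quad P x].
  by move/sub; rewrite /= max_quadZ.
apply: smallest_sub => [M1 M2 t|_ [i _ <-]]; last exact: max_quad_contract.
rewrite !inE /= => M1x M2x.
set lhs := (X in max_quad P X).
have -> : lhs = t%:num *: (gamma *: (M1 *m x)) +
    (1 - t%:num) *: (gamma *: (M2 *m x)).
  rewrite /lhs [_ *m _]mulmxDl -!scalemxAl scalerDr !scalerA.
  by rewrite ![gamma * _]mulrC.
have t01 : 0 <= t%:num <= (1 : R) by rewrite ge0 le1.
apply: (le_trans (max_quad_convex hP _ _ t01)).
case/andP: t01 => t0 t1.
have -> : max_quad P x = t%:num * max_quad P x + (1 - t%:num) * max_quad P x.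
  by rewrite -mulrDl subrKC mul1r.
by rewrite lerD// ler_wpM2l ?subr_ge0.
Qed.

Lemma inclusion_decay : exists2 B, 0 < B & forall x k, inclusion_traj A x ->
  `|x k| <= B * `|x 0%N| * gamma^-1 ^+ k.
Proof.
have g0 : 0 < gamma by exact: lt_trans hgamma.
have [B B0 hB] := norm_le_of_max_quad_decay hP; exists B => // x k xA.
apply: hB => //; elim: k => [|k IH]; first by rewrite mul1r.
have [M MA <-] := xA k; apply: le_trans IH.
by rewrite exprSr -mulrA ler_pM2l ?exprn_gt0// max_quad_contract_hull.
Qed.

(** The j-th column of a product is the state reached from the j-th basis vector,
    so it obeys the decay of trajectories. *)
Lemma switch_prod_decay : exists2 B, 0 < B & forall s,
  `|switch_prod A s| <= B * gamma^-1 ^+ size s.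
Proof.
have g0 : 0 < gamma by exact: lt_trans hgamma.
have [B B0 hB] := norm_le_of_max_quad_decay hP; exists B => // s.
have Bg0 : 0 <= B * gamma^-1 ^+ size s.
  by rewrite mulr_ge0 ?exprn_ge0 ?invr_ge0 ?(ltW g0) ?(ltW B0).
apply/(mx_norm_leP _ Bg0) => i j.
pose e : 'cV[R]_n := delta_mx j 0.
have -> : switch_prod A s i j = (switch_prod A s *m e) i 0.
  by rewrite -colE mxE.
apply: (le_trans (normr_coord_le _ _ _)).
have e1 : `|e| <= 1.
  apply/(mx_norm_leP e ler01) => k l; rewrite mxE.
  by case: andP; rewrite ?normr1 ?normr0.
suff : `|switch_prod A s *m e| <= B * `|e| * gamma^-1 ^+ size s.
  move/le_trans; apply; rewrite ler_wpM2r ?exprn_ge0 ?invr_ge0 ?(ltW g0)//.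
  by rewrite -[leRHS]mulr1 ler_wpM2l ?(ltW B0).
apply: hB => //; elim/last_ind: s {Bg0} => [|s k IH].
  by rewrite /switch_prod big_nil mul1mx mul1r.
rewrite switch_prod_rcons size_rcons -mulmxA; apply: le_trans IH.
rewrite exprSr -mulrA ler_pM2l ?exprn_gt0//.
by apply: max_quad_contract_hull; exact: mxhull_mem.
Qed.
End contraction.

(** * Asymptotic stability and the joint spectral radius *)

Lemma gas_of_decay (R : realType) n (traj : set (nat -> 'cV[R]_n)) (B q : R) :
  0 < B -> 0 <= q < 1 ->
  (forall x k, traj x -> `|x k| <= B * `|x 0%N| * q ^+ k) -> gas traj.
Proof.
move=> B0 /andP[q0 q1] hB; split=> [eps eps0|x trx].
  exists (eps / B) => [|x trx]; first exact: divr_gt0.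
  rewrite ltr_pdivlMr// mulrC => xe k; apply: le_lt_trans xe.
  apply: (le_trans (hB x k trx)).
  by rewrite ler_piMr ?mulr_ge0 ?(ltW B0)// exprn_ile1 ?(ltW q1).
apply/norm_cvg0P.
apply: (@squeeze_cvgr _ _ _ _ (fun=> 0) (fun k => B * `|x 0%N| * q ^+ k)).
- by apply: nearW => k; rewrite normr_ge0 hB.
- exact: cvg_cst.
- rewrite -[X in _ --> X](mulr0 (B * `|x 0%N|)); apply: cvgMr.
  by apply: cvg_expr; rewrite ger0_norm.
Qed.

(** Taking roots is nondecreasing, so it commutes with the maximum; this reduces
    the joint spectral radius to the roots of one sequence. *)
Lemma jsr_seqE (R : realType) n m (N : 'M[R]_n -> R) (A : 'I_m.+1 -> 'M[R]_n) :
  is_mxnorm N -> jsr_seq N A =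
  fun k =>
    (\big[Num.max/0]_(s : k.-tuple 'I_m.+1) N (switch_prod A s)) `^ k%:R^-1.
Proof.
move=> hN; apply/funext => k; rewrite /jsr_seq.
have N0 (s : k.-tuple 'I_m.+1) : 0 <= N (switch_prod A s) by exact: mxnorm_ge0.
pose s0 : k.-tuple 'I_m.+1 := [tuple of nseq k ord0].
apply/le_anti/andP; split.
  apply: bigmax_le => [|s _]; first exact: powR_ge0.
  apply: ge0_ler_powR; rewrite ?nnegrE ?invr_ge0//.
    by apply: le_trans (N0 s) _; exact: le_bigmax.
  exact: le_bigmax.
rewrite (bigmax_eq_arg _ s0)//.
pose F (s : k.-tuple 'I_m.+1) := N (switch_prod A s) `^ k%:R^-1.
exact: (le_bigmax _ F).
Qed.

(** Splitting a word of length k + l into its first k and last l letters makes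
    the maxima [b] submultiplicative up to a constant. *)
Lemma jsr_cvg_le (R : realType) n m (N : 'M[R]_n -> R) (A : 'I_m.+1 -> 'M[R]_n)
    (B q : R) : is_mxnorm N -> 0 < B -> 0 <= q ->
  (forall s, `|switch_prod A s| <= B * q ^+ size s) ->
  cvgn (jsr_seq N A) /\ jsr N A <= q.
Proof.
move=> hN B0 q0 hB; rewrite /jsr jsr_seqE//.
pose b k := \big[Num.max/0]_(s : k.-tuple 'I_m.+1) N (switch_prod A s).
have b0 k : 0 <= b k by exact: bigmax_ge_id.
have Nb (s : seq 'I_m.+1) : N (switch_prod A s) <= b (size s).
  pose F (t : (size s).-tuple 'I_m.+1) := N (switch_prod A t).
  exact: (le_bigmax _ F (in_tuple s)).
have cb : cvgn (fun k => b k `^ k%:R^-1).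
  have [C C0 NM] := mxnorm_mulmx hN.
  apply: (cvg_root_quasi_submultiplicative C0 b0) => k l.
  apply: bigmax_le => [|s _]; first by rewrite !mulr_ge0 ?(ltW C0).
  rewrite -(cat_take_drop k s) switch_prod_cat (le_trans (NM _ _))//.
  rewrite ler_wpM2l ?(ltW C0)// mulrC.
  have := Nb (take k s); rewrite size_takel ?size_tuple ?leq_addr// => Nk.
  have := Nb (drop k s); rewrite size_drop size_tuple addKn => Nl.
  by rewrite ler_pM ?mxnorm_ge0.
split=> //; have [C C0 NC] := mxnorm_le hN.
apply: (@lim_root_le _ b (C * B)) => // [|k]; first exact: mulr_gt0.
rewrite b0 /=; apply: bigmax_le => [|s _].
  by rewrite !mulr_ge0 ?exprn_ge0 ?(ltW C0) ?(ltW B0).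
rewrite (le_trans (NC _))// -mulrA ler_wpM2l ?(ltW C0)//.
by rewrite (le_trans (hB s))// size_tuple.
Qed.

Unset Implicit Arguments.
Set Strict Implicit.

Theorem corollary3p5 (R : realType) (n m K : nat) (A : 'I_m.+1 -> 'M[R]_n)
  (P : 'I_K.+1 -> 'M[R]_n) (gamma : R)
  (hP : forall j, posdefmx (P j))
  (hgamma : 1 < gamma)
  (hA : forall (i : 'I_m.+1) (j : 'I_K.+1), exists k : 'I_K.+1,
     loewner_le (gamma ^+ 2 *: ((A i)^T *m P j *m A i)) (P k)) :
  [/\ switched_aas A,
      inclusion_aas A,
      (forall N : 'M[R]_n -> R, is_mxnorm N ->
         cvgn (jsr_seq N A) /\ jsr N A < 1)
    & common_lyapunov A (max_quad P)].
Proof.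
have g0 : 0 < gamma by exact: lt_trans hgamma.
have q01 : 0 <= gamma^-1 < 1 by rewrite invr_ge0 (ltW g0) invf_lt1.
have /andP[q0 q1] := q01.
have [B B0 hB] := inclusion_decay hP hgamma hA.
have V0 : max_quad P 0 = 0 by rewrite -(scale0r 0) max_quadZ expr0n mul0r.
split.
- move=> sigma; apply: (gas_of_decay B0 q01) => x k [k0 xA]; apply: hB => l.
  by exists (A (sigma (k0 + l%:Z))); [exact: mxhull_mem | rewrite xA].
- by apply: (gas_of_decay B0 q01) => x k; exact: hB.
- move=> N hN; have [D D0 hD] := switch_prod_decay hP hgamma hA.
  by have [? jq] := jsr_cvg_le hN D0 q0 hD; split=> //; exact: le_lt_trans q1.
split.
- exact: max_quad_continuous.
- by split=> // x; exact: max_quad_gt0.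
- by exists 2%N => // a x; exact: max_quadZ.
- by exists gamma => // i x; exact: max_quad_contract.
Qed.
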